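(* Let \(R\) be a commutative ring flat over \(\mathbb{Z}\), and let \[f(t)=\sum_{u\in\mathbb{Z}^d}a_u t^u\in R[t_1,\ldots,t_d,(t_1\cdots t_d)^{-1}]\] be a Laurent polynomial whose Newton polytope \(\Delta\) (the convex hull in \(\mathbb{R}^d\) of \(\{u: a_u\neq 0\}\)) has dimension \(d\) and whose interior \(\Delta^\circ\) contains at least one lattice point. Let \(F_f(x,y)\in (R\otimes\mathbb{Q})[\![x,y]\!]\) be the formal group law defined below. Then \(F_f(x,y)\in R[\![x,y]\!]\), i.e. all coefficients of \(F_f\) lie in \(R\).
   Context: For \(v,w\in\Delta^\circ\cap\mathbb{Z}^d\) and \(\nu\ge 1\), let \(\beta_{v,w,\nu}\in R\) be the coefficient of \(t^{\nu w-v}\) in \(f(t)^{\nu-1}\). Put \(L_{v,w}(\tau)=\sum_{\nu\ge1}\beta_{v,w,\nu}\tau^\nu/\nu\) and, with variables \(\tau_w\) (\(w\in\Delta^\circ\cap\mathbb{Z}^d\)), \(L_v(\tau)=\sum_{w\in\Delta^\circ\cap\mathbb{Z}^d}L_{v,w}(\tau_w)\). Then \(L=(L_v)_{v\in\Delta^\circ\cap\mathbb{Z}^d}\) is an \(N\)-tuple of power series over \(R\otimes\mathbb{Q}\) in \(N=\#(\Delta^\circ\cap\mathbb{Z}^d)\) variables, with linear part the identity. Define, with \(x=(x_w)\), \(y=(y_w)\) indexed by \(\Delta^\circ\cap\mathbb{Z}^d\), \(F_f(x,y)=L^{-1}(L(x)+L(y))\), an \(N\)-dimensional formal group law over \(R\otimes\mathbb{Q}\).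 *)

(* Defs.v *)
From HB Require Import structures.
From mathcomp Require Import all_boot all_order all_algebra finmap.
From mathcomp Require Import boolp classical_sets functions cardinality reals.
From mathcomp Require Import interval_inference topology normedtype convex.
(* The notations of mpoly and of the topology files cannot be loaded together. *)
From mathcomp Require Import -(notations) mpoly.

Set Implicit Arguments.
Unset Strict Implicit.
Unset Printing Implicit Defensive.

Import Order.TTheory GRing.Theory Num.Theory.
Import numFieldNormedType.Exports.

Local Open Scope classical_set_scope.
Local Open Scope ring_scope.

Definition biadditive (M N P : zmodType) (b : M -> N -> P) : Prop :=
  (forall x, {morph b x : y z / y + z}) /\
  (forall y, {morph b^~ y : x z / x + z}).

(* The map t : M -> N -> T exhibits T as the tensor product of M and N over the
   integers. *)
Definition is_tensorZ (M N T : zmodType) (t : M -> N -> T) : Prop :=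
  biadditive t /\
  forall (P : zmodType) (b : M -> N -> P), biadditive b ->
    exists h : {additive T -> P},
      (forall x y, h (t x y) = b x y) /\
      forall h' : {additive T -> P}, (forall x y, h' (t x y) = b x y) -> h' =1 h.

(* Tensoring with M over the integers preserves injections; g is the map
   induced by f. *)
Definition flatZ (M : zmodType) : Prop :=
  forall (A B TA TB : zmodType) (tA : M -> A -> TA) (tB : M -> B -> TB)
         (f : {additive A -> B}) (g : {additive TA -> TB}),
    is_tensorZ tA -> is_tensorZ tB ->
    (forall x a, g (tA x a) = tB x (f a)) ->
    injective f -> injective g.

(* Laurent polynomials: f u is the coefficient of t^u. *)
Definition laurent (d : nat) (R : nzRingType) : Type :=
  {fsfun 'rV[int]_d -> R with 0}.

Section Laurent.
Variables (d : nat) (R : nzRingType).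
Implicit Types f g : laurent d R.

Definition lone : laurent d R := [fsfun u in [fset 0]%fset => 1].

Definition lmul f g : laurent d R :=
  [fsfun m in [fset (u.1 + u.2)%R | u in (finsupp f `*` finsupp g)%fset]%fset
     => \sum_(u <- finsupp f) f u * g (m - u)].

Definition lpow f (n : nat) : laurent d R := iter n (lmul f) lone.

Lemma loneE u : lone u = (u == 0)%:R.
Proof. by rewrite fsfunE inE; case: (u == 0). Qed.

Lemma lmulE f g m : lmul f g m = \sum_(u <- finsupp f) f u * g (m - u).
Proof.
rewrite fsfunE; case: ifPn => // mfg; rewrite big_seq big1 // => u uf.
case: (finsuppP g (m - u)) => [_|ug]; first by rewrite mulr0.
case/negP: mfg; apply/imfsetP; exists (u, m - u); last by rewrite /= subrKC.
by rewrite /= in_fsetE uf ug.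
Qed.

End Laurent.

Section NewtonPolytope.
Variables (RR : realType) (d : nat).

Definition embZ (u : 'rV[int]_d) : 'rV[RR]_d := map_mx intr u.

Definition conv_hull (A : set 'rV[RR]_d) : set 'rV[RR]_d :=
  \bigcap_(C in [set C : set 'rV[RR]_d | convex_set C /\ A `<=` C]) C.

(* n is the dimension of the affine hull of A, whose direction V is the linear
   span of the differences of elements of A. *)
Definition has_dim (A : set 'rV[RR]_d) (n : nat) : Prop :=
  A !=set0 /\
  exists V : {vspace 'rV[RR]_d},
    [/\ forall x y, A x -> A y -> x - y \in V,
        forall W : {vspace 'rV[RR]_d},
          (forall x y, A x -> A y -> x - y \in W) -> (V <= W)%VS
      & \dim V = n].

Variable R : nzRingType.
Implicit Type f : laurent d R.

Definition newton f : set 'rV[RR]_d :=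
  conv_hull [set x | exists2 u, f u != 0 & x = embZ u].

Definition interior_lattice f : set 'rV[int]_d :=
  [set v | interior (newton f) (embZ v)].

(* fset_set is only meaningful on finite sets; see interior_ptsE. *)
Definition interior_pts f : seq 'rV[int]_d :=
  enum_fset (fset_set (interior_lattice f)).

Lemma finite_interior_lattice f : finite_set (interior_lattice f).
Proof.
pose B := (\sum_(u <- finsupp f) \sum_j `|u ord0 j|)%N.
have uB u j : f u != 0 -> (`|u ord0 j| <= B)%N.
  move=> fu; have uf : u \in finsupp f by rewrite mem_finsupp.
  rewrite /B (big_fsetD1 u uf) /= (bigD1 j) //=.
  by rewrite -addnA leq_addr.
pose C : set 'rV[RR]_d := [set x | forall j, `|x 0 j| <= B%:R].
have newtonC : newton f `<=` C.
  apply: bigcap_inf; split.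
    move=> x y l; rewrite !inE => Cx Cy j; rewrite !mxE.
    apply: le_trans (ler_normD _ _) _; rewrite !normrM.
    have -> : B%:R = `|(l%:num)%R| * B%:R + `|(1 - l%:num)%R| * B%:R :> RR.
      by rewrite -mulrDl !ger0_norm ?subr_ge0 // addrC subrK mul1r.
    by apply: lerD; apply: ler_wpM2l.
  move=> _ [u fu ->] j; rewrite mxE -intr_norm.
  by rewrite -[B%:R]/(B%:~R) ler_int -abszE lez_nat uB.
pose g (x : 'rV['I_(B + B).+1]_d) : 'rV[int]_d :=
  map_mx (fun k : 'I_(B + B).+1 => k%:Z - B%:Z) x.
apply: (@sub_finite_set _ _ (g @` setT)); last first.
  by apply: finite_image; exact: finite_finset.
move=> v /interior_subset /newtonC Cv.
have vB j : `|v 0 j| <= B%:Z.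
  by have := Cv j; rewrite mxE -intr_norm -[B%:R]/(B%:~R) ler_int.
exists (\row_j inord `|(v ord0 j + B%:Z)%R|%N) => //.
apply/rowP => j; rewrite !mxE; have := vB j; rewrite ler_norml => /andP[v1 v2].
have v0 : 0 <= v 0 j + B%:Z by rewrite -lerBlDr sub0r.
rewrite inordK ?gez0_abs // ?addrK //.
by rewrite ltnS -lez_nat gez0_abs // PoszD lerD2r.
Qed.

Lemma interior_ptsE f v : (v \in interior_pts f) <-> interior_lattice f v.
Proof.
have := in_fset_set (finite_interior_lattice f) v.
rewrite /interior_pts /= => ->.
by split; rewrite inE.
Qed.

Lemma uniq_interior_pts f : uniq (interior_pts f).
Proof. exact: fset_uniq. Qed.

End NewtonPolytope.

Arguments newton RR {d R} f _.
Arguments interior_lattice RR {d R} f _.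

(* Power series in N variables: F m is the coefficient of X^m. *)
Definition mpowser (N : nat) (K : nzRingType) : Type := multinom N -> K.

Section PowerSeries.
Variable K : comNzRingType.

Definition ps_trunc N (k : nat) (F : mpowser N K) : mpoly N K :=
  \sum_(m : bmultinom N k.+1) F m *: mpolyX K m.

Definition ps_X N (i : 'I_N) : mpowser N K := fun m => (m == mnm1 i)%:R.

(* The substitution G(H_0, H_1, ...) for series H_j without constant term: in
   total degree k it only depends on the terms of degree at most k of G and of
   the H_j. *)
Definition ps_comp M N (G : mpowser M K) (H : 'I_M -> mpowser N K) :
    mpowser N K :=
  fun m => mcoeff m (comp_mpoly [tuple ps_trunc (mdeg m) (H j) | j < M]
                                (ps_trunc (mdeg m) G)).

(* Inverse under composition of a tuple L = X + (terms of degree >= 2): the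
   fixed point of M |-> X - (L - X)(M), whose k-th iterate from 0 is exact up to
   degree k.  See ps_comp_inv and ps_inv_unique. *)
Definition ps_inv_step N (L M : 'I_N -> mpowser N K) : 'I_N -> mpowser N K :=
  fun i m => ps_X i m - ps_comp (fun m' => L i m' - ps_X i m') M m.

Definition ps_inv N (L : 'I_N -> mpowser N K) : 'I_N -> mpowser N K :=
  fun i m => iter (mdeg m) (ps_inv_step L) (fun _ _ => 0) i m.

(* L^-1(L(x) + L(y)), where x_k and y_k are the variables of indices lshift N k
   and rshift N k. *)
Definition fg_of_log N (L : 'I_N -> mpowser N K) :
    'I_N -> mpowser (N + N) K :=
  fun i => ps_comp (ps_inv L i)
    (fun j m => ps_comp (L j) (fun k => ps_X (lshift N k)) m
              + ps_comp (L j) (fun k => ps_X (rshift N k)) m).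

Definition agree N (k : nat) (F G : mpowser N K) : Prop :=
  forall m, (mdeg m <= k)%N -> F m = G m.

Lemma mcoeff_ps_trunc N k (F : mpowser N K) m :
  mcoeff m (ps_trunc k F) = if (mdeg m <= k)%N then F m else 0.
Proof.
rewrite /ps_trunc raddf_sum /=; case: ifPn => [mk|mk].
  have mk' : (mdeg m < k.+1)%N by [].
  rewrite (bigD1 (BMultinom mk')) //= mcoeffZ mcoeffX eqxx mulr1.
  rewrite big1 ?addr0 // => m'; rewrite bmeqP /= => /negbTE nm.
  by rewrite mcoeffZ mcoeffX nm mulr0.
rewrite big1 // => m' _; rewrite mcoeffZ mcoeffX; case: eqP => [e|]; last first.
  by rewrite mulr0.
by case/negP: mk; rewrite -e; have := bmdeg m'.
Qed.

Lemma ps_compE M N (G : mpowser M K) (H : 'I_M -> mpowser N K) m :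
  ps_comp G H m = \sum_(u : bmultinom M (mdeg m).+1)
    G u * mcoeff m (\prod_j ps_trunc (mdeg m) (H j) ^+ bmnm u j).
Proof.
rewrite /ps_comp {2}/ps_trunc (raddf_sum (comp_mpoly _)) raddf_sum /=.
apply: eq_bigr => u _.
rewrite comp_mpolyZ mcoeffZ comp_mpolyX; congr (_ * mcoeff m _).
by apply: eq_bigr => j _; rewrite tnth_mktuple.
Qed.

Definition close N k e (a b : mpoly N K) : Prop :=
  [/\ forall m, (mdeg m < e)%N -> mcoeff m a = 0,
      forall m, (mdeg m < e)%N -> mcoeff m b = 0
    & forall m, (mdeg m < k + e)%N -> mcoeff m a = mcoeff m b].

Lemma mcoeffM_low N a b (p q : mpoly N K) :
  (forall m, (mdeg m < a)%N -> mcoeff m p = 0) ->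
  (forall m, (mdeg m < b)%N -> mcoeff m q = 0) ->
  forall m, (mdeg m < a + b)%N -> mcoeff m (p * q) = 0.
Proof.
move=> Hp Hq m mab; rewrite mcoeffM big1 // => k /eqP e.
have [ka|ka] := ltnP (mdeg k.1) a; first by rewrite Hp ?mul0r.
rewrite Hq ?mulr0 // -(ltn_add2l a); apply: leq_ltn_trans mab.
by apply: (@leq_trans (mdeg k.1 + mdeg k.2)); rewrite ?leq_add2r // -mdegD -e.
Qed.

Lemma closeM N k e e' (a b a' b' : mpoly N K) :
  close k e a b -> close k e' a' b' -> close k (e + e') (a * a') (b * b').
Proof.
move=> [a0 b0 ab] [a'0 b'0 ab']; split; try exact: mcoeffM_low.
move=> m mk; apply/eqP; rewrite -subr_eq0 -mcoeffB.
have -> : a * a' - b * b' = a * (a' - b') + (a - b) * b'.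
  by rewrite mulrBr mulrBl addrA subrK.
rewrite mcoeffD (@mcoeffM_low _ e (k + e')) ?add0r //.
- rewrite (@mcoeffM_low _ (k + e) e') -?addnA // => m' m'k.
  by rewrite mcoeffB ab // subrr.
- by move=> m' m'k; rewrite mcoeffB ab' // subrr.
- by rewrite addnCA.
Qed.

Lemma close1 N k : close k 0 (1 : mpoly N K) 1.
Proof. by split. Qed.

Lemma closeX N k (a b : mpoly N K) n :
  close k 1 a b -> close k n (a ^+ n) (b ^+ n).
Proof.
move=> ab; elim: n => [|n IH]; first exact: close1.
by rewrite !exprS; apply: (@closeM _ _ 1 n).
Qed.

Lemma close_prod M N k (a b : 'I_M -> mpoly N K) (u : multinom M) :
  (forall j, close k 1 (a j) (b j)) ->
  close k (mdeg u) (\prod_j a j ^+ u j) (\prod_j b j ^+ u j).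
Proof.
move=> ab; rewrite mdegE; apply: (big_ind3 (close k)).
- exact: close1.
- by move=> *; apply: closeM.
- by move=> j _; apply: closeX.
Qed.

Lemma agree_comp M N k (G : mpowser M K) (H H' : 'I_M -> mpowser N K) :
  (forall u, (mdeg u <= 1)%N -> G u = 0) ->
  (forall j, H j (@mnm0 N) = 0) -> (forall j, H' j (@mnm0 N) = 0) ->
  (forall j, agree k (H j) (H' j)) -> agree k.+1 (ps_comp G H) (ps_comp G H').
Proof.
move=> G0 H0 H'0 HH' m mk; rewrite !ps_compE; apply: eq_bigr => u _.
have [u1|u1] := leqP (mdeg u) 1; first by rewrite G0 ?mul0r.
congr (_ * _).
have cl j : close k 1 (ps_trunc (mdeg m) (H j)) (ps_trunc (mdeg m) (H' j)).
  split=> m'; rewrite ?mcoeff_ps_trunc.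
  - by rewrite ltnS leqn0 mdeg_eq0 => /eqP->; rewrite H0 if_same.
  - by rewrite ltnS leqn0 mdeg_eq0 => /eqP->; rewrite H'0 if_same.
  - by rewrite addn1 ltnS => m'k; rewrite HH'.
have [_ _] := close_prod u cl; apply.
by apply: (leq_ltn_trans mk); rewrite -addn1 ltn_add2l.
Qed.

Lemma agree_compr M N (G : mpowser M K) (H H' : 'I_M -> mpowser N K) m :
  (forall j, agree (mdeg m) (H j) (H' j)) -> ps_comp G H m = ps_comp G H' m.
Proof.
move=> HH'; rewrite /ps_comp; congr (mcoeff m (comp_mpoly _ _)).
apply: eq_from_tnth => j; rewrite !tnth_mktuple; apply/mpolyP => m'.
by rewrite !mcoeff_ps_trunc; case: ifP => // m'm; rewrite HH'.
Qed.

Lemma ps_compX N M (i : 'I_M) (H : 'I_M -> mpowser N K) m :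
  H i (@mnm0 N) = 0 -> ps_comp (ps_X i) H m = H i m.
Proof.
move=> H0; rewrite ps_compE; have [m0|m0] := posnP (mdeg m).
  rewrite big1; first by move/eqP: m0; rewrite mdeg_eq0 => /eqP->.
  move=> u _; rewrite /ps_X; case: eqP => [e|_]; last by rewrite mul0r.
  by have := bmdeg u; rewrite e mdeg1 m0.
have i1 : (mdeg (mnm1 i) < (mdeg m).+1)%N by rewrite mdeg1 ltnS.
rewrite (bigD1 (BMultinom i1)) /= ?inE // [X in _ + X]big1 => [|u]; last first.
  by rewrite bmeqP /ps_X /= => /negbTE->; rewrite mul0r.
rewrite /ps_X eqxx mul1r addr0 (bigD1 i) //= big1 => [|j ji]; last first.
  by rewrite mnm1E eq_sym (negbTE ji) expr0.
by rewrite mnm1E eqxx expr1 mulr1 mcoeff_ps_trunc leqnn.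
Qed.

Lemma ps_compB M N (G G' : mpowser M K) (H : 'I_M -> mpowser N K) m :
  ps_comp (fun u => G u - G' u) H m = ps_comp G H m - ps_comp G' H m.
Proof.
by rewrite !ps_compE -sumrB; apply: eq_bigr => u _; rewrite mulrBl.
Qed.

Section Inverse.
Variables (N : nat) (L : 'I_N -> mpowser N K).
Hypothesis L0 : forall i, L i (@mnm0 N) = 0.
Hypothesis L1 : forall i j, L i (mnm1 j) = (i == j)%:R.

Let D i : mpowser N K := fun m => L i m - ps_X i m.

Let D0 i u : (mdeg u <= 1)%N -> D i u = 0.
Proof.
rewrite leq_eqVlt ltnS leqn0 mdeg_eq0 /D /ps_X => /orP[|/eqP->]; last first.
  by rewrite L0 eq_sym mnm1_eq0 subrr.
by rewrite mdeg_eq1 => /existsP[j /eqP->]; rewrite L1 eq_mnm1 eq_sym subrr.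
Qed.

Let comp0 M i : ps_comp (D i) M (@mnm0 N) = 0.
Proof.
rewrite ps_compE big1 // => u _; rewrite D0 ?mul0r //.
by apply: ltnW; apply: (leq_trans (bmdeg u)); rewrite mdeg0.
Qed.

Let step0 M i : ps_inv_step L M i (@mnm0 N) = 0.
Proof.
by rewrite /ps_inv_step comp0 subr0 /ps_X eq_sym mnm1_eq0.
Qed.

Let It k := iter k (ps_inv_step L) (fun _ _ => 0).

Let It0 k i : It k i (@mnm0 N) = 0.
Proof. by case: k => // k; rewrite [It _]iterS step0. Qed.

Let agree0 (F G : mpowser N K) :
  F (@mnm0 N) = 0 -> G (@mnm0 N) = 0 -> agree 0 F G.
Proof.
by move=> F0 G0 m; rewrite leqn0 mdeg_eq0 => /eqP->; rewrite F0 G0.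
Qed.

Let agree_step k M M' :
  (forall i, M i (@mnm0 N) = 0) -> (forall i, M' i (@mnm0 N) = 0) ->
  (forall i, agree k (M i) (M' i)) ->
  forall i, agree k.+1 (ps_inv_step L M i) (ps_inv_step L M' i).
Proof.
move=> M0 M'0 MM' i m mk; rewrite /ps_inv_step; congr (_ - _).
exact: (agree_comp (@D0 i) M0 M'0 MM').
Qed.

Let agreeS k i : agree k (It k i) (It k.+1 i).
Proof.
elim: k i => [|k IH] i; first exact: agree0.
exact: agree_step.
Qed.

Let agree_It k l i : agree k (It k i) (It (k + l) i).
Proof.
elim: l => [|l IH] m mk; first by rewrite addn0.
by rewrite IH // addnS agreeS // (leq_trans mk) // leq_addr.
Qed.

Let agree_inv k i : agree k (ps_inv L i) (It k i).
Proof.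
by move=> m mk; rewrite /ps_inv -[in RHS](subnKC mk) -(@agree_It _ _ _ m).
Qed.

Let comp_D M i m : (forall i, M i (@mnm0 N) = 0) ->
  ps_comp (D i) M m = ps_comp (L i) M m - M i m.
Proof. by move=> M0; rewrite ps_compB ps_compX. Qed.

Lemma ps_inv0 i : ps_inv L i (@mnm0 N) = 0.
Proof. by rewrite /ps_inv mdeg0. Qed.

Lemma ps_comp_inv i m : ps_comp (L i) (ps_inv L) m = ps_X i m.
Proof.
have := comp_D i m ps_inv0.
rewrite (@agree_compr _ _ _ _ (It (mdeg m))) => [DE|j]; last exact: agree_inv.
have E : ps_inv L i m = ps_X i m - (ps_comp (L i) (ps_inv L) m - ps_inv L i m).
  by rewrite -DE; exact: (@agreeS (mdeg m) i m (leqnn _)).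
by move/eqP: E; rewrite eq_sym subr_eq addrC subrK => /eqP.
Qed.

Lemma ps_inv_unique (M : 'I_N -> mpowser N K) :
  (forall i, M i (@mnm0 N) = 0) ->
  (forall i m, ps_comp (L i) M m = ps_X i m) ->
  forall i m, M i m = ps_inv L i m.
Proof.
move=> M0 LM.
have stepM i m : M i m = ps_inv_step L M i m.
  by rewrite /ps_inv_step comp_D // LM subKr.
have agM k i : agree k (M i) (It k i).
  elim: k i => [|k IH] i m mk; first exact: agree0.
  by rewrite stepM; apply: (agree_step M0 _ IH).
by move=> i m; exact: (agM (mdeg m)).
Qed.

End Inverse.

(* g(X_i) for a univariate power series g. *)
Definition ps_in_var N (i : 'I_N) (g : nat -> K) : mpowser N K :=
  fun m => if m == mnm_muln (mnm1 i) (m i) then g (m i) else 0.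

End PowerSeries.

Section LaurentFormalGroup.
Variables (RR : realType) (d : nat) (R RQ : comNzRingType).
Variables (iR : {rmorphism R -> RQ}) (iQ : {rmorphism rat -> RQ}).
Variable f : laurent d R.

Definition lbeta (v w : 'rV[int]_d) (nu : nat) : R :=
  lpow f nu.-1 (w *+ nu - v).

Definition logLvw (v w : 'rV[int]_d) (nu : nat) : RQ :=
  if nu == 0%N then 0 else iR (lbeta v w nu) * iQ (nu%:R^-1).

Let pts := interior_pts RR f.

Definition logL (i : 'I_(size pts)) : mpowser (size pts) RQ :=
  fun m => \sum_(j < size pts)
    ps_in_var j (logLvw (nth 0 pts i) (nth 0 pts j)) m.

Lemma logL0 i : logL i mnm0 = 0.
Proof.
rewrite /logL big1 // => j _; rewrite /ps_in_var /logLvw mnm0E.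
by case: ifP.
Qed.

Lemma logL1 i j : logL i (mnm1 j) = (i == j)%:R.
Proof.
rewrite /logL (bigD1 j) //= big1 => [|k kj]; last first.
  rewrite /ps_in_var /logLvw mnm1E [j == k]eq_sym (negbTE kj) /=.
  by case: ifP.
rewrite addr0 /ps_in_var mnm1E eqxx.
have -> : mnm_muln (mnm1 j) true = mnm1 j by apply/mnmP => k; rewrite mulmnE muln1.
rewrite eqxx /logLvw /= /lbeta /= loneE mulr1n invr1 rmorph1 mulr1 rmorph_nat.
by rewrite subr_eq0 nth_uniq ?uniq_interior_pts // eq_sym.
Qed.

Definition laurent_fg : 'I_(size pts) -> mpowser (size pts + size pts) RQ :=
  fg_of_log logL.

End LaurentFormalGroup.

Arguments laurent_fg RR {d R RQ} iR iQ f _ _.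

(* Main.v *)
Require Import Defs.
From HB Require Import structures.
From mathcomp Require Import all_boot all_order all_algebra finmap.
From mathcomp Require Import boolp classical_sets functions reals.
From mathcomp Require Import interval_inference topology normedtype convex.
From mathcomp Require Import -(notations) mpoly.
From mathcomp Require Import ring.

Set Implicit Arguments.
Unset Strict Implicit.
Unset Printing Implicit Defensive.

Import Order.TTheory GRing.Theory Num.Theory.
Import numFieldNormedType.Exports.

Local Open Scope ring_scope.

(* Formally, L_v(tau) is the constant term of
     - (t^v / f) sum_w log (1 - tau_w f t^(-w)),
   so L_v (z) is the value at h = prod_w (1 - z_w f t^(-w)) of the homomorphism
   - CT ((t^v / f) log h) on the group of series 1 + f g, with g in the positive
   part of R[t, 1/t][[x, y]].  If u is a lattice point outside the interior of
   the Newton polytope, then 1 + c f t^(-u) lies in the kernel of all these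
   homomorphisms: f^(n-1) has no monomial t^(n u - v), because otherwise u would
   be the mean of v and of n - 1 points of the polytope, hence interior.
   By successive approximation every 1 + f g is a product of such elements and
   of prod_w (1 - z_w f t^(-w)) with z_w in R[[x, y]].  Applied to
   prod_w (1 - x_w f t^(-w)) (1 - y_w f t^(-w)), this gives z over R with
   L (z) = L (x) + L (y), so z is the formal group law.  Denominators are
   avoided by replacing log h by its logarithmic derivative along the Euler
   vector field of the variables x, y. *)

(** * The ring of Laurent polynomials *)

Section LaurentRing.
Variables (d : nat) (R : comNzRingType).
Implicit Types (f g h : laurent d R) (u v m : 'rV[int]_d) (a b : R).

HB.instance Definition _ :=
  Equality.copy (laurent d R) {fsfun 'rV[int]_d -> R with 0}.
HB.instance Definition _ := gen_choiceMixin (laurent d R).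

Definition lzero : laurent d R := [fsfun].
Definition lopp f : laurent d R := [fsfun u in finsupp f => - f u].
Definition ladd f g : laurent d R :=
  [fsfun u in (finsupp f `|` finsupp g)%fset => f u + g u].
Definition lmono u a : laurent d R := [fsfun v in [fset u]%fset => a].

Lemma laurentP f g : f =1 g -> f = g.
Proof. by move=> fg; apply/fsfunP. Qed.

Lemma loppE f u : lopp f u = - f u.
Proof. by rewrite fsfunE; case: finsuppP => //; rewrite oppr0. Qed.

Lemma laddE f g u : ladd f g u = f u + g u.
Proof.
rewrite fsfunE in_fsetU.
by case: (finsuppP f u) => uf; case: (finsuppP g u) => ug; rewrite ?addr0.
Qed.

Lemma lmonoE u a v : lmono u a v = if v == u then a else 0.
Proof. by rewrite fsfunE inE. Qed.

Let laddA : associative ladd.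
Proof. by move=> f g h; apply: laurentP => u; rewrite !laddE addrA. Qed.
Let laddC : commutative ladd.
Proof. by move=> f g; apply: laurentP => u; rewrite !laddE addrC. Qed.
Let ladd0 : left_id lzero ladd.
Proof. by move=> f; apply: laurentP => u; rewrite laddE fsfun0E add0r. Qed.
Let laddN : left_inverse lzero lopp ladd.
Proof.
by move=> f; apply: laurentP => u; rewrite laddE loppE fsfun0E addNr.
Qed.

HB.instance Definition _ :=
  GRing.isZmodule.Build (laurent d R) laddA laddC ladd0 laddN.

Lemma l0E u : (0 : laurent d R) u = 0.
Proof. exact: fsfun0E. Qed.

Lemma lDE f g u : (f + g) u = f u + g u.
Proof. exact: laddE. Qed.

Lemma lNE f u : (- f) u = - f u.
Proof. exact: loppE. Qed.

Lemma lsumE I (r : seq I) (P : pred I) (F : I -> laurent d R) u :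
  (\sum_(i <- r | P i) F i) u = \sum_(i <- r | P i) F i u.
Proof. by apply: (big_morph (fun f : laurent d R => f u)) => [f g|];
  rewrite ?lDE ?l0E. Qed.

Lemma laurent_lmono f : f = \sum_(u <- finsupp f) lmono u (f u).
Proof.
apply: laurentP => v; rewrite lsumE.
under eq_bigr do rewrite lmonoE.
case: (finsuppP f v) => [vf|vf].
  rewrite big_seq big1 // => u uf; case: eqP => // e.
  by move: vf; rewrite e uf.
rewrite (big_fsetD1 v) //= eqxx big_seq big1 ?addr0 // => u.
by rewrite in_fsetD1 eq_sym => /andP[/negbTE ->].
Qed.

(** Enlarging the support of the left factor lets products with different left factors be compared
    over one index set. *)
Lemma lmul_sub f g (S : {fset 'rV[int]_d}) m : (finsupp f `<=` S)%fset ->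
  lmul f g m = \sum_(u <- S) f u * g (m - u).
Proof.
move=> fS; rewrite lmulE; apply: big_fset_incl => // u _ uf.
by rewrite fsfun_dflt ?mul0r.
Qed.

Let lmulDl : left_distributive (@lmul d R) +%R.
Proof.
move=> f g h; apply: laurentP => m.
pose S := (finsupp (f + g)%R `|` (finsupp f `|` finsupp g))%fset.
rewrite lDE !(@lmul_sub _ _ S) ?fsubsetUl //.
- by rewrite -big_split; apply: eq_bigr => u _; rewrite lDE mulrDl.
- by rewrite /S fsetUA fsubsetUr.
- by rewrite /S fsetUC -fsetUA fsubsetUl.
Qed.

Let lmulDr : right_distributive (@lmul d R) +%R.
Proof.
move=> f g h; apply: laurentP => m.
by rewrite lDE !lmulE -big_split; apply: eq_bigr => u _; rewrite lDE mulrDr.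
Qed.

Let lmul_suml I (r : seq I) (F : I -> laurent d R) g :
  lmul (\sum_(i <- r) F i) g = \sum_(i <- r) lmul (F i) g.
Proof.
apply: (big_morph (fun f => lmul f g)) => [f h|]; first exact: lmulDl.
apply: laurentP => m; rewrite l0E (@lmul_sub _ _ fset0) ?big_nil //.
by rewrite finsupp0.
Qed.

Let lmul_sumr I (r : seq I) (F : I -> laurent d R) g :
  lmul g (\sum_(i <- r) F i) = \sum_(i <- r) lmul g (F i).
Proof.
apply: (big_morph (fun f => lmul g f)) => [f h|]; first exact: lmulDr.
by apply: laurentP => m; rewrite l0E lmulE big1 // => u _; rewrite l0E mulr0.
Qed.

Lemma lmul_lmonoE u a g m : lmul (lmono u a) g m = a * g (m - u).
Proof.
rewrite (@lmul_sub _ _ [fset u]%fset) ?big_seq_fset1 ?lmonoE ?eqxx //.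
apply/fsubsetP => v; rewrite mem_finsupp lmonoE inE.
by case: (v == u); rewrite ?eqxx.
Qed.

Lemma lmul_lmono u v a b : lmul (lmono u a) (lmono v b) = lmono (u + v) (a * b).
Proof.
apply: laurentP => m; rewrite lmul_lmonoE !lmonoE subr_eq [v + u]addrC.
by case: ifP; rewrite ?mulr0.
Qed.

(** By bilinearity [f] and [g] may be taken to be monomials; multiplication by a monomial is a shift
    and a scaling, so [h] stays arbitrary. *)
Let lmulA : associative (@lmul d R).
Proof.
move=> f g h; rewrite (laurent_lmono f) !lmul_suml; apply: eq_bigr => u _.
rewrite (laurent_lmono g) lmul_suml !lmul_sumr lmul_suml.
apply: eq_bigr => v _; rewrite lmul_lmono; apply: laurentP => m.
by rewrite !lmul_lmonoE mulrA opprD addrA.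
Qed.

Let lmulC : commutative (@lmul d R).
Proof.
move=> f g; rewrite (laurent_lmono f) (laurent_lmono g).
rewrite lmul_suml lmul_sumr; apply: eq_bigr => u _.
rewrite lmul_suml lmul_sumr; apply: eq_bigr => v _.
by rewrite !lmul_lmono addrC mulrC.
Qed.

Let lone_lmono : @lone d R = lmono 0 1.
Proof. by apply: laurentP => u; rewrite loneE. Qed.

Let lmul1 : left_id (@lone d R) (@lmul d R).
Proof.
by move=> f; apply: laurentP => m; rewrite lone_lmono lmul_lmonoE mul1r subr0.
Qed.

Let lone_neq0 : @lone d R != 0.
Proof.
apply/eqP => /fsfunP/(_ 0); rewrite loneE l0E eqxx => /eqP.
by rewrite oner_eq0.
Qed.

HB.instance Definition _ := GRing.Zmodule_isComNzRing.Build (laurent d R)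
  lmulA lmulC lmul1 lmulDl lone_neq0.

Lemma lpowE f n : lpow f n = f ^+ n.
Proof. by elim: n => //= n ->; rewrite exprS. Qed.

Definition lconst a : laurent d R := lmono 0 a.

Let lconst_zmod : zmod_morphism lconst.
Proof.
move=> a b; apply: laurentP => u; rewrite lDE lNE /lconst. rewrite !lmonoE.
by case: eqP; rewrite ?subr0.
Qed.
Let lconst_monoid : monoid_morphism lconst.
Proof.
split=> [|a b]; first by rewrite /lconst -lone_lmono.
by rewrite /lconst -[RHS]/(lmul _ _) lmul_lmono addr0.
Qed.
HB.instance Definition _ :=
  GRing.isZmodMorphism.Build R (laurent d R) lconst lconst_zmod.
HB.instance Definition _ :=
  GRing.isMonoidMorphism.Build R (laurent d R) lconst lconst_monoid.

Lemma lmonoM u v a b : lmono u a * lmono v b = lmono (u + v) (a * b).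
Proof. exact: lmul_lmono. Qed.

Lemma lmonoX u n : lmono u 1 ^+ n = lmono (u *+ n) 1.
Proof.
elim: n => [|n IH]; first exact: lone_lmono.
by rewrite exprS IH lmonoM mulr1 mulrS.
Qed.

Lemma lmonoME u a g m : (lmono u a * g) m = a * g (m - u).
Proof. exact: lmul_lmonoE. Qed.

Definition lcoef u f : R := f u.

Let lcoef_zmod u : zmod_morphism (lcoef u).
Proof. by move=> f g; rewrite /lcoef lDE lNE. Qed.
HB.instance Definition _ u :=
  GRing.isZmodMorphism.Build (laurent d R) R (lcoef u) (lcoef_zmod u).

End LaurentRing.

(** * The order filtration and composition of power series *)

Section Order.
Variables (N : nat) (K : comNzRingType).
Implicit Types (p q : mpoly N K) (n : nat).

(** Membership in the [n]-th power of the ideal generated by the variables; congruences modulo this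
    power are written [low n (p - q)]. *)
Definition low n p : Prop := forall m, (mdeg m < n)%N -> mcoeff m p = 0.

Lemma low0 n : low n 0.
Proof. by move=> m _; rewrite mcoeff0. Qed.

Lemma lowD n p q : low n p -> low n q -> low n (p + q).
Proof. by move=> Hp Hq m mn; rewrite mcoeffD Hp // Hq // addr0. Qed.

Lemma lowN n p : low n p -> low n (- p).
Proof. by move=> Hp m mn; rewrite mcoeffN Hp // oppr0. Qed.

Lemma lowB n p q : low n p -> low n q -> low n (p - q).
Proof. by move=> Hp Hq; apply/lowD/lowN. Qed.

Lemma low_sum n I (r : seq I) (P : pred I) (F : I -> mpoly N K) :
  (forall i, P i -> low n (F i)) -> low n (\sum_(i <- r | P i) F i).
Proof. by move=> HF; apply: big_ind => //; [exact: low0|exact: lowD]. Qed.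

Lemma lowM a b p q : low a p -> low b q -> low (a + b) (p * q).
Proof. exact: mcoeffM_low. Qed.

Lemma low_leq a b p : (a <= b)%N -> low b p -> low a p.
Proof. by move=> ab Hp m ma; apply/Hp/(leq_trans ma). Qed.

Lemma lowMr n p q : low n p -> low n (p * q).
Proof. by move=> Hp; rewrite -[n]addn0; apply: lowM => // m. Qed.

Lemma lowMl n p q : low n q -> low n (p * q).
Proof. by rewrite mulrC; apply: lowMr. Qed.

Lemma lowX n p : low 1 p -> low n (p ^+ n).
Proof.
by move=> p1; elim: n => [|n IH]; [move=> m|rewrite exprS; apply: (lowM p1 IH)].
Qed.

Lemma low_eq n p q m : low n (p - q) -> (mdeg m < n)%N ->
  mcoeff m p = mcoeff m q.
Proof. by move=> pq /pq /eqP; rewrite mcoeffB subr_eq0 => /eqP. Qed.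

Lemma low_trans n p q r : low n (p - q) -> low n (q - r) -> low n (p - r).
Proof. by move=> pq /(lowD pq); rewrite addrA subrK. Qed.

Lemma low_sym n p q : low n (p - q) -> low n (q - p).
Proof. by move/lowN; rewrite opprB. Qed.

Lemma low_refl n p : low n (p - p).
Proof. by rewrite subrr; apply: low0. Qed.

Lemma low_congrM n p p' q q' :
  low n (p - p') -> low n (q - q') -> low n (p * q - p' * q').
Proof.
move=> Hp Hq; apply: (@low_trans _ _ (p' * q)).
  by rewrite -mulrBl; apply: lowMr.
by rewrite -mulrBr; apply: lowMl.
Qed.

Lemma low_congrX n p p' e : low n (p - p') -> low n (p ^+ e - p' ^+ e).
Proof.
move=> pp'; elim: e => [|e IH]; first exact: low_refl.
by rewrite !exprS; apply: low_congrM.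
Qed.

Lemma low_congr_sum n I (r : seq I) (P : pred I) (F G : I -> mpoly N K) :
  (forall i, P i -> low n (F i - G i)) ->
  low n (\sum_(i <- r | P i) F i - \sum_(i <- r | P i) G i).
Proof. by move=> FG; rewrite -sumrB; apply: low_sum. Qed.

End Order.

Section Composition.
Variables (K : comNzRingType).

Lemma low_comp M N n (lq : M.-tuple (mpoly N K)) (p : mpoly M K) :
  (forall j, low 1 (tnth lq j)) -> low n p -> low n (comp_mpoly lq p).
Proof.
move=> lq1 pn; rewrite comp_mpolyE; apply: low_sum => u _ m mn.
rewrite mcoeffZ; have [un|un] := ltnP (mdeg u) n; first by rewrite pn ?mul0r.
(* With equal arguments and [k = 0], [close] only records the vanishing of the constant term;
   [close_prod] then bounds the order of a product of powers from below. *)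
have cl j : Defs.close 0 1 (tnth lq j) (tnth lq j) by split=> //; apply: lq1.
by have [-> //] := close_prod u cl; rewrite ?mulr0 // (leq_trans mn).
Qed.

Lemma low_congr_comp M N n (lq lq' : M.-tuple (mpoly N K)) (p : mpoly M K) :
  (forall j, low n (tnth lq j - tnth lq' j)) ->
  low n (comp_mpoly lq p - comp_mpoly lq' p).
Proof.
move=> qq'; rewrite !comp_mpolyE; apply: low_congr_sum => u _.
rewrite -scalerBr -mul_mpolyC; apply: lowMl.
apply: (big_ind2 (fun a b => low n (a - b))); first exact: low_refl.
  by move=> *; apply: low_congrM.
by move=> j _; apply: low_congrX.
Qed.

Lemma comp_mpolyA L M N (lq : L.-tuple (mpoly M K)) (lr : M.-tuple (mpoly N K))
    (p : mpoly L K) :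
  comp_mpoly lr (comp_mpoly lq p) =
  comp_mpoly [tuple comp_mpoly lr (tnth lq j) | j < L] p.
Proof.
rewrite !(comp_mpolyE p) raddf_sum /=; apply: eq_bigr => u _.
rewrite comp_mpolyZ rmorph_prod /=; congr (_ *: _); apply: eq_bigr => j _.
by rewrite rmorphXn tnth_mktuple.
Qed.

Lemma low_ps_trunc N k (F : mpowser N K) (p : mpoly N K) :
  agree k F (fun m => mcoeff m p) -> low k.+1 (ps_trunc k F - p).
Proof.
by move=> Fp m mk; rewrite mcoeffB mcoeff_ps_trunc ifT // Fp ?subrr.
Qed.

Lemma agree_ps_trunc N k (F : mpowser N K) :
  agree k F (fun m => mcoeff m (ps_trunc k F)).
Proof. by move=> m mk; rewrite mcoeff_ps_trunc mk. Qed.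

(** Passage from series to polynomials: in degrees up to [k], a composition may be computed with any
    polynomial representatives. *)
Lemma agree_comp_mpoly M N k (G : mpowser M K) (H : 'I_M -> mpowser N K)
    (q : mpoly M K) (p : 'I_M -> mpoly N K) :
  agree k G (fun m => mcoeff m q) ->
  (forall j, agree k (H j) (fun m => mcoeff m (p j))) ->
  (forall j, low 1 (p j)) ->
  agree k (ps_comp G H) (fun m => mcoeff m (comp_mpoly [tuple p j | j < M] q)).
Proof.
move=> Gq Hp p1 m mk; apply: (@low_eq _ _ (mdeg m).+1) => //.
have sub (N' : nat) (F F' : mpowser N' K) : agree k F F' -> agree (mdeg m) F F'.
  by move=> FF' m' m'm; apply/FF'/(leq_trans m'm).
apply: (@low_trans _ _ _ _ (comp_mpoly [tuple p j | j < M]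
                                       (ps_trunc (mdeg m) G))).
  apply: low_congr_comp => j; rewrite !tnth_mktuple.
  exact/low_ps_trunc/sub/Hp.
rewrite -raddfB; apply: low_comp => [j|]; first by rewrite tnth_mktuple.
exact/low_ps_trunc/sub/Gq.
Qed.

Lemma low1_ps_trunc N k (F : mpowser N K) :
  F (@mnm0 N) = 0 -> low 1 (ps_trunc k F).
Proof.
move=> F0 m; rewrite ltnS leqn0 mdeg_eq0 => /eqP->.
by rewrite mcoeff_ps_trunc F0 if_same.
Qed.

Lemma ps_compA L M N (A : mpowser L K) (B : 'I_L -> mpowser M K)
    (C : 'I_M -> mpowser N K) m :
  (forall j, B j (@mnm0 M) = 0) -> (forall j, C j (@mnm0 N) = 0) ->
  ps_comp (ps_comp A B) C m = ps_comp A (fun j => ps_comp (B j) C) m.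
Proof.
move=> B0 C0; set k := mdeg m.
pose b j := ps_trunc k (B j); pose c j := ps_trunc k (C j).
have b1 j : low 1 (b j) by exact: low1_ps_trunc.
have c1 j : low 1 (c j) by exact: low1_ps_trunc.
have lc : forall j, low 1 (tnth [tuple c j | j < M] j).
  by move=> j; rewrite tnth_mktuple.
have AB := agree_comp_mpoly (@agree_ps_trunc _ k A)
             (fun j => @agree_ps_trunc _ k (B j)) b1.
have BC j := agree_comp_mpoly (@agree_ps_trunc _ k (B j))
             (fun j => @agree_ps_trunc _ k (C j)) c1.
rewrite (agree_comp_mpoly AB (fun j => @agree_ps_trunc _ k (C j)) c1) //.
rewrite (agree_comp_mpoly (@agree_ps_trunc _ k A) BC) //; last first.
  by move=> j; exact: (low_comp lc (b1 j)).
rewrite comp_mpolyA; congr (mcoeff m (comp_mpoly _ _)).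
by apply: eq_from_tnth => j; rewrite !tnth_mktuple.
Qed.

(** [L] is the identity plus terms of degree at least 2. If [H] and [H'] agree to degree [n], these
    terms composed with them agree to degree [n + 1], so the linear part passes the agreement of
    [L (H)] and [L (H')] on to [H] and [H']. *)
Lemma ps_comp_inj M N (L : 'I_M -> mpowser M K) (H H' : 'I_M -> mpowser N K) k :
  (forall i, L i (@mnm0 M) = 0) ->
  (forall i j, L i (mnm1 j) = (i == j)%:R) ->
  (forall j, H j (@mnm0 N) = 0) -> (forall j, H' j (@mnm0 N) = 0) ->
  (forall i, agree k (ps_comp (L i) H) (ps_comp (L i) H')) ->
  forall i, agree k (H i) (H' i).
Proof.
move=> L0 L1 H0 H'0 LH.
suff agn n : (n <= k)%N -> forall i, agree n (H i) (H' i) by exact: agn.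
elim: n => [_ i m|n IH nk i m mn].
  by rewrite leqn0 mdeg_eq0 => /eqP->; rewrite H0 H'0.
have D0 u : (mdeg u <= 1)%N -> L i u - ps_X K i u = 0.
  rewrite leq_eqVlt ltnS leqn0 mdeg_eq0 /ps_X => /orP[|/eqP->]; last first.
    by rewrite L0 eq_sym mnm1_eq0 subrr.
  by rewrite mdeg_eq1 => /existsP[j /eqP->]; rewrite L1 eq_mnm1 eq_sym subrr.
have := agree_comp D0 H0 H'0 (IH (ltnW nk)) mn.
by rewrite !ps_compB !ps_compX // LH ?(leq_trans mn) // => /addrI/oppr_inj.
Qed.

End Composition.

(** * Logarithmic derivatives *)

Section Euler.
Variables (N : nat) (K : comNzRingType).
Implicit Types (p q : mpoly N K).

(** The Euler derivation, the sum of the [X_i d/dX_i]. *)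
Definition euler p : mpoly N K :=
  \sum_(m <- msupp p) (mcoeff m p *+ mdeg m) *: mpolyX K m.

Lemma mcoeff_euler m p : mcoeff m (euler p) = mcoeff m p *+ mdeg m.
Proof.
rewrite /euler raddf_sum /=; under eq_bigr do rewrite mcoeffZ mcoeffX.
have [mp|mp] := boolP (m \in msupp p).
  rewrite (bigD1_seq m) ?msupp_uniq //= eqxx mulr1 big1 ?addr0 // => u.
  by move/negbTE->; rewrite mulr0.
rewrite (memN_msupp_eq0 mp) mul0rn big_seq big1 // => u up.
by case: eqP => [e|_]; rewrite ?mulr0 //; move: mp; rewrite -e up.
Qed.

Lemma euler_zmod : zmod_morphism euler.
Proof.
by move=> p q; apply/mpolyP => m; rewrite mcoeffB !mcoeff_euler mcoeffB mulrnBl.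
Qed.
HB.instance Definition _ :=
  GRing.isZmodMorphism.Build (mpoly N K) (mpoly N K) euler euler_zmod.

Lemma eulerB p q : euler (p - q) = euler p - euler q.
Proof. exact: raddfB. Qed.

Lemma eulerN p : euler (- p) = - euler p.
Proof. exact: raddfN. Qed.

Lemma eulerD p q : euler (p + q) = euler p + euler q.
Proof. exact: raddfD. Qed.

Lemma eulerM p q : euler (p * q) = euler p * q + p * euler q.
Proof.
apply/mpolyP => m; rewrite mcoeffD mcoeff_euler !mcoeffM -sumrMnl -big_split.
apply: eq_bigr => u /eqP mu /=.
rewrite !mcoeff_euler mulrnAl mulrnAr -mulrnDr; congr (_ *+ _).
by rewrite -mdegD -mu.
Qed.

Lemma eulerC c : euler (mpolyC N c) = 0.
Proof.
apply/mpolyP => m; rewrite mcoeff_euler mcoeffC mcoeff0.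
by case: eqP => [->|_]; rewrite ?mdeg0 ?mulr0n // mulr0 mul0rn.
Qed.

Lemma eulerX p n : euler (p ^+ n.+1) = (p ^+ n * euler p) *+ n.+1.
Proof.
elim: n => [|n IH]; first by rewrite expr1 expr0 mul1r.
by rewrite exprS eulerM IH mulrnAr mulrA -exprS mulrC -mulrS.
Qed.

Lemma eulerZ c p : euler (c *: p) = c *: euler p.
Proof. by apply/mpolyP => m; rewrite mcoeffZ !mcoeff_euler mcoeffZ mulrnAr. Qed.

Lemma low_euler n p : low n p -> low n (euler p).
Proof. by move=> pn m mn; rewrite mcoeff_euler pn // mul0rn. Qed.

End Euler.

Lemma euler_map N (K K' : comNzRingType) (h : {rmorphism K -> K'})
    (p : mpoly N K) :
  euler (map_mpoly h p) = map_mpoly h (euler p).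
Proof.
apply/mpolyP => m.
by rewrite mcoeff_euler !mcoeff_map_mpoly mcoeff_euler raddfMn.
Qed.

(** * The composition law on [g] that multiplies the elements [1 + a g] *)

Section Star.
Variables (T : comNzRingType) (a : T).
Implicit Types g h : T.

(* 1 + a (star a g h) = (1 + a g) (1 + a h), even when a is a zero divisor. *)
Definition star g h : T := g + h + a * g * h.

Lemma starA : associative star.
Proof. by move=> g h g'; rewrite /star; ring. Qed.
Lemma starC : commutative star.
Proof. by move=> g h; rewrite /star; ring. Qed.
Lemma star0 : left_id 0 star.
Proof. by move=> g; rewrite /star; ring. Qed.
HB.instance Definition _ := Monoid.isComLaw.Build T 0 star starA starC star0.

(** Replacing addition of [b] by a further factor [1 + a b] costs [b] times a multiple of [a], which
    has higher order when [g] and [h] have no constant term. *)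
Lemma star_addr g h b : star g h + b - star g (star h b) =
  - (b * (a * h + a * g + a * g * (a * h))).
Proof. by rewrite /star; ring. Qed.

(** The same estimate when [b] is absorbed into an existing factor. *)
Lemma star_addl g h h' b : star (star g h) h' + b - star (star (g + b) h) h' =
  - (b * (a * h' + a * h + a * h * (a * h'))).
Proof. by rewrite /star; ring. Qed.

Lemma star_logder g h g' h' w x :
  g' + h' + (a * g' * h + a * g * h') - (1 + a * star g h) * (w + x) =
  (g' - (1 + a * g) * w) * (1 + a * h) + (h' - (1 + a * h) * x) * (1 + a * g).
Proof. by rewrite /star; ring. Qed.

Lemma logder_congr_id g h x y w : y - (1 + a * h) * w =
  x - (1 + a * g) * w - (x - y - a * (g - h) * w).
Proof. by ring. Qed.

Lemma logder_inj_id g y w x :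
  w - x = y - (1 + a * g) * x - (y - (1 + a * g) * w) - a * (g * (w - x)).
Proof. by ring. Qed.

Lemma logder_mono_id m t u n :
  (- (a * (m * t))) ^+ n * (u * t) = a ^+ n * t ^+ n.+1 * ((- m) ^+ n * u) :> T.
Proof.
rewrite -mulrN -mulNr !exprMn exprSr.
by move: (a ^+ n) ((- m) ^+ n) (t ^+ n) => x y z; ring.
Qed.

End Star.

(** * Logarithmic derivatives of [1 + f g] up to degree [k] *)

Section LogDerivative.
Variables (R K : comNzRingType) (iota : {rmorphism R -> K}) (f : K) (V k : nat).
Local Notation B := (mpoly V K).
Local Notation fB := (mpolyC V f).
Local Notation starB := (star fB).
Implicit Types (g h : B).

Lemma low_star n g h : low n g -> low n h -> low n (starB g h).
Proof. by move=> Hg Hh; do ![apply: lowD => //]; apply: lowMl. Qed.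

(* w stands for the logarithmic derivative of 1 + f g, divided by f. *)
Definition logder g w : Prop := low k.+1 (euler g - (1 + fB * g) * w).

Lemma logder_star g w h x :
  logder g w -> logder h x -> logder (starB g h) (w + x).
Proof.
move=> Hg Hh; rewrite /logder !eulerD !eulerM eulerC mul0r add0r.
rewrite star_logder.
by apply: lowD; apply: lowMr.
Qed.

Lemma logder_congr g h w : low k.+1 (g - h) -> logder g w -> logder h w.
Proof.
move=> gh Hg; rewrite /logder.
have -> : euler h - (1 + fB * h) * w =
      euler g - (1 + fB * g) * w - (euler (g - h) - fB * (g - h) * w).
  by rewrite eulerB; exact: logder_congr_id.
apply/lowB/lowB => //; first exact: low_euler.
by apply: lowMr; apply: lowMl.
Qed.

(** As [g] has no constant term, [1 + f g] is invertible modulo every order: the identity below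
    expresses [w - x] through [g * (w - x)], which raises its order by one at each round. *)
Lemma logder_inj g w x :
  low 1 g -> logder g w -> logder g x -> low k.+1 (w - x).
Proof.
move=> g1 Hw Hx; suff H n : (n <= k.+1)%N -> low n (w - x) by exact: H.
elim: n => [_ m //|n IH nk].
have -> : w - x = euler g - (1 + fB * g) * x - (euler g - (1 + fB * g) * w)
    - fB * (g * (w - x)) by exact: logder_inj_id.
apply: lowB; first by apply: (low_leq nk); apply: lowB.
by apply: lowMl; apply: (lowM g1); apply: IH; apply: ltnW.
Qed.

(** Keeping [c] over [R], apart from the scalar [t] of [K], is what later makes integrality
    visible. *)
Definition tmono (c : mpoly V R) (t : K) : B := map_mpoly iota c * mpolyC V t.

Lemma low_tmono n c t : low n c -> low n (tmono c t).
Proof.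
move=> cn; apply: lowMr => m mn; rewrite mcoeff_map_mpoly cn //.
exact: raddf0.
Qed.

Lemma tmonoD c c' t : tmono (c + c') t = tmono c t + tmono c' t.
Proof. by rewrite /tmono raddfD mulrDl. Qed.

Lemma tmono_oppB c c' t : tmono (- (c - c')) t = tmono (- c) t + tmono c' t.
Proof. by rewrite -tmonoD (opprB c c') (addrC c'). Qed.

Lemma euler_tmono c t : euler (tmono c t) = tmono (euler c) t.
Proof. by rewrite /tmono eulerM eulerC mulr0 addr0 euler_map. Qed.

(** The truncated geometric series of the Euler derivative of [c t] divided by [1 + f c t]. *)
Definition logder_tmono_val (c : mpoly V R) t : B :=
  \sum_(n < k.+1) (- (fB * tmono c t)) ^+ n * tmono (euler c) t.

Lemma logder_tmono c t : low 1 c -> logder (tmono c t) (logder_tmono_val c t).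
Proof.
move=> c1; rewrite /logder euler_tmono /logder_tmono_val -mulr_suml mulrA.
set y := fB * _; rewrite -[in X in X * _ * _](opprK y).
have := subrX1 (- y) k.+1; set S := \sum_(i < _) _ => E.
have -> : (1 - - y) * S = 1 - (- y) ^+ k.+1.
  by apply: oppr_inj; rewrite opprB E -mulNr opprB.
(* The truncation error is a multiple of [y ^+ k.+1], hence invisible up to degree [k]. *)
have -> : tmono (euler c) t - (1 - (- y) ^+ k.+1) * tmono (euler c) t =
  (- y) ^+ k.+1 * tmono (euler c) t.
  by rewrite mulrBl mul1r opprB addrC subrK.
by apply: lowMr; apply: lowX; apply: lowN; apply: lowMl; apply: low_tmono.
Qed.

Lemma mcoeff_logder_tmono_val c t m :
  mcoeff m (logder_tmono_val c t) =
  \sum_(n < k.+1) iota (mcoeff m ((- c) ^+ n * euler c)) * (f ^+ n * t ^+ n.+1).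
Proof.
rewrite /logder_tmono_val raddf_sum /=; apply: eq_bigr => n _.
have -> : (- (fB * tmono c t)) ^+ n * tmono (euler c) t =
    mpolyC V (f ^+ n * t ^+ n.+1) * map_mpoly iota ((- c) ^+ n * euler c).
  by rewrite !rmorphM !rmorphXn raddfN; exact: logder_mono_id.
by rewrite mcoeffCM mcoeff_map_mpoly mulrC.
Qed.

End LogDerivative.

(** * Factorization and integrality *)

Section Integrality.
Variables (R K : comNzRingType) (iota : {rmorphism R -> K}) (f : K).
Variables (V k N : nat).
(* For Laurent polynomials, tau e = t^(-e), ev i is the coefficient of t^(- w i),
   and beta i e n that of t^((n+1) e - w i) in f^n. *)
Variables (E : eqType) (tau : E -> K) (w : 'I_N -> E).
Variables (ev : 'I_N -> {additive K -> R}) (beta : 'I_N -> E -> nat -> R).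
Local Notation B := (mpoly V K).
Local Notation A := (mpoly V R).
Local Notation fB := (mpolyC V f).
Local Notation starB := (star fB).
Local Notation tmonoI := (tmono iota).
Implicit Types (c : A) (g h : B) (l : 'I_N -> A) (z : 'I_N -> A).

Hypothesis tau_gen : forall x : K, exists s : seq (R * E),
  x = \sum_(re <- s) iota re.1 * tau re.2.
Hypothesis ev_beta : forall i r e n,
  ev i (iota r * (f ^+ n * tau e ^+ n.+1)) = r * beta i e n.
(** The geometry of the Newton polytope enters the factorization only through this vanishing. *)
Hypothesis beta_notin : forall i e n, (forall j, e != w j) -> beta i e n = 0.

(** Up to sign, [l i] is the Euler derivative of the [i]-th logarithmic homomorphism at [1 + f g],
    in degrees at most [k]. *)
Definition log_val g l : Prop := exists2 x, logder f k g x &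
  forall i m, (mdeg m <= k)%N -> ev i (mcoeff m x) = mcoeff m (l i).

Lemma log_val_star g h l l' :
  log_val g l -> log_val h l' -> log_val (starB g h) (fun i => l i + l' i).
Proof.
move=> [x gx xl] [y hy yl]; exists (x + y); first exact: logder_star.
by move=> i m mk; rewrite !mcoeffD raddfD xl // yl.
Qed.

Lemma log_val0 : log_val 0 (fun=> 0).
Proof.
exists 0; last by move=> i m _; rewrite !mcoeff0 raddf0.
by rewrite /logder raddf0 mulr0 subr0; apply: low0.
Qed.

Lemma log_val_inj g h l l' : low 1 g -> low k.+1 (g - h) ->
  log_val g l -> log_val h l' -> forall i, low k.+1 (l i - l' i).
Proof.
move=> g1 gh [x gx xl] [y hy yl] i m mk; rewrite mcoeffB -xl // -yl //.
have := logder_inj g1 gx (logder_congr (low_sym gh) hy).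
by move/low_eq => ->; rewrite ?subrr.
Qed.

Lemma log_val_big (I : finType) (F : I -> B) (l : I -> 'I_N -> A) :
  (forall j, log_val (F j) (l j)) ->
  log_val (\big[starB/0]_j F j) (fun i => \sum_j l j i).
Proof.
move=> Fl; rewrite /index_enum; elim: (Finite.enum _) => [|j r IH].
  rewrite big_nil; have [x ? xl] := log_val0; exists x => // i m mk.
  by rewrite big_nil xl.
rewrite big_cons; have [x ? xl] := log_val_star (Fl j) IH.
by exists x => // i m mk; rewrite xl // big_cons.
Qed.

(** The Euler derivative of [L_i (z)], truncated at exponent [k + 1]: differentiating
    [z_j ^ (n+1) / (n+1)] leaves no denominator, so this is defined over [R]. *)
Definition dlog z i : A := \sum_j \sum_(n < k.+1)
  beta i (w j) n *: (z j ^+ n * @euler V R (z j)).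

Lemma ev_logder_tmono_val c e i m :
  ev i (mcoeff m (logder_tmono_val iota f k c (tau e))) =
  \sum_(n < k.+1) mcoeff m ((- c) ^+ n * @euler V R c) * beta i e n.
Proof.
rewrite mcoeff_logder_tmono_val raddf_sum.
by apply: eq_bigr => n _; rewrite ev_beta.
Qed.

Lemma log_val_tmono_in c j : low 1 c -> log_val (tmonoI (- c) (tau (w j)))
  (fun i => - \sum_(n < k.+1) beta i (w j) n *: (c ^+ n * @euler V R c)).
Proof.
move=> c1; exists (logder_tmono_val iota f k (- c) (tau (w j))).
  exact/logder_tmono/lowN.
move=> i m mk; rewrite ev_logder_tmono_val mcoeffN raddf_sum /= -sumrN.
apply: eq_bigr => n _.
by rewrite opprK eulerN mulrN mcoeffN mulNr mcoeffZ mulrC.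
Qed.

Lemma log_val_tmono_notin c e : low 1 c -> (forall j, e != w j) ->
  log_val (tmonoI c (tau e)) (fun=> 0).
Proof.
move=> c1 ew; exists (logder_tmono_val iota f k c (tau e)).
  exact: logder_tmono.
move=> i m mk; rewrite ev_logder_tmono_val mcoeff0 big1 // => n _.
by rewrite beta_notin ?mulr0.
Qed.

(** [1 + f * wprod z] is the product of the factors [1 - z_j f tau (w_j)]. *)
Definition wprod z : B := \big[starB/0]_j tmonoI (- z j) (tau (w j)).

Lemma low_wprod z : (forall j, low 1 (z j)) -> low 1 (wprod z).
Proof.
move=> z1; apply: big_ind; [exact: low0|exact: low_star|].
by move=> j _; apply/low_tmono/lowN.
Qed.

Lemma log_val_wprod z : (forall j, low 1 (z j)) ->
  log_val (wprod z) (fun i => - dlog z i).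
Proof.
move=> z1; have [x ? xl] := log_val_big (fun j => log_val_tmono_in j (z1 j)).
by exists x => // i m mk; rewrite xl // sumrN.
Qed.

(** Modulo order [n], [1 + f g] factors into the product given by [z] and an element [1 + f h] on
    which all homomorphisms vanish up to degree [k]. *)
Definition approx n g : Prop := exists z h,
  [/\ forall j, low 1 (z j), low 1 h, log_val h (fun=> 0)
    & low n (g - starB (wprod z) h)].

(* Absorbs the monomial c t^e either into z_j if e = w_j, or, if there is no
   such j, into the factor of trivial logarithm. *)
Lemma approx_add n g z h c e : (0 < n)%N -> low n c ->
  (forall j, low 1 (z j)) -> low 1 h -> log_val h (fun=> 0) ->
  low n.+1 (g - (starB (wprod z) h + tmonoI c (tau e))) -> approx n.+1 g.
Proof.
move=> n0 cn z1 h1 hl gzh; have c1 : low 1 c by apply: low_leq cn.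
(* The error terms of [star_addr] and [star_addl]: order [n] from [b], and one more from [x] and
   [y]. *)
have lowterm (b x y : B) : low n b -> low 1 x -> low 1 y ->
    low n.+1 (- (b * (fB * x + fB * y + fB * y * (fB * x)))).
  move=> bn x1 y1; apply: lowN; rewrite -addn1; apply: lowM => //.
  by do ![apply: lowD]; apply: lowMl => //; apply: lowMl.
have cen := low_tmono iota (tau e) cn.
have [/existsP[j /eqP ej]|] := boolP [exists j, e == w j]; last first.
  rewrite negb_exists => /forallP ew.
  exists z, (starB h (tmonoI c (tau e))); split=> //.
  - by apply: low_star => //; apply: low_tmono.
  - have [x ? xl] := log_val_star hl (log_val_tmono_notin c1 ew).
    by exists x => // i m mk; rewrite xl // addr0.
  - apply: (low_trans gzh); rewrite (star_addr fB (wprod z) h).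
    by apply: lowterm => //; apply: low_wprod.
(* The factor carries [- z j], so adding [c] to it means subtracting [c] from [z j]. *)
pose z' i := if i == j then z i - c else z i.
have z'1 i : low 1 (z' i) by rewrite /z'; case: eqP => // _; apply: lowB.
exists z', h; split=> //; apply: (low_trans gzh).
pose Q := \big[starB/0]_(i < N | i != j) tmonoI (- z i) (tau (w i)).
have -> : wprod z' = starB (tmonoI (- z j) (tau e) + tmonoI c (tau e)) Q.
  rewrite /wprod (bigD1 j isT).
  have -> : z' j = z j - c by rewrite /z' eqxx.
  rewrite -ej tmono_oppB; congr star.
  by apply: eq_bigr => i /negbTE ij; rewrite /z' ij.
have -> : wprod z = starB (tmonoI (- z j) (tau e)) Q.
  by rewrite /wprod (bigD1 j) //= -ej.
rewrite (star_addl fB _ Q h); apply: lowterm => //.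
apply: big_ind; [exact: low0|exact: low_star|].
by move=> i _; apply/low_tmono/lowN.
Qed.

Lemma approx_sum n g (s : seq (A * E)) z h : (0 < n)%N ->
  (forall c e, (c, e) \in s -> low n c) ->
  (forall j, low 1 (z j)) -> low 1 h -> log_val h (fun=> 0) ->
  low n.+1 (g - (starB (wprod z) h + \sum_(ce <- s) tmonoI ce.1 (tau ce.2))) ->
  approx n.+1 g.
Proof.
move=> n0; elim: s g => [|[c e] s IH] g sn z1 h1 hl.
  by rewrite big_nil addr0 => gzh; exists z, h.
rewrite big_cons /= => gzh.
have [|||||z' [h' [z'1 h'1 h'l gzh']]] := IH (g - tmonoI c (tau e)) => //.
- by move=> c' e' ces; apply: (sn c' e'); rewrite inE ces orbT.
- by rewrite -addrA -opprD addrCA.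
- apply: (approx_add n0 _ z'1 h'1 h'l (c := c) (e := e)).
    by apply: (sn c e); rewrite inE eqxx.
  by move: gzh'; rewrite -addrA -opprD [tmonoI _ _ + _]addrC.
Qed.

Lemma tmono_gen n g : low n g -> exists2 s : seq (A * E),
  forall c e, (c, e) \in s -> low n c &
  g = \sum_(ce <- s) tmonoI ce.1 (tau ce.2).
Proof.
move=> gn; pose s m := projT1 (cid (tau_gen (mcoeff m g))).
have sE m : mcoeff m g = \sum_(re <- s m) iota re.1 * tau re.2.
  by rewrite /s; case: cid.
exists [seq (re.1 *: mpolyX R m, re.2) | m <- msupp g, re <- s m].
  move=> c e /allpairsPdep[m [re [mg _ [-> _]]]] u un.
  rewrite mcoeffZ mcoeffX; case: eqP => [e'|_]; last by rewrite mulr0.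
  by move: mg; rewrite mcoeff_msupp gn ?eqxx // e'.
rewrite big_allpairs_dep {1}(mpolyE g); apply: eq_bigr => m _.
rewrite {1}sE scaler_suml; apply: eq_bigr => re _.
rewrite /tmono map_mpolyZ map_mpolyX /= [RHS]mulrC mul_mpolyC scalerA.
by rewrite [in RHS]mulrC.
Qed.

(** Successive approximation: the error left at order [n] is a finite sum of terms [c * tau e], and
    absorbing all of them creates errors of order [n + 1] only. *)
Lemma approxP n g : low 1 g -> approx n.+1 g.
Proof.
move=> g1; elim: n => [|n [z [h [z1 h1 hl gzh]]]].
  exists (fun=> 0), 0; split=> [_|||].
  - exact: low0.
  - exact: low0.
  - exact: log_val0.
  - apply: lowB => //; apply: low_star; last exact: low0.
    by apply: low_wprod => j; apply: low0.
have [s sn sE] := tmono_gen gzh.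
apply: (@approx_sum _ _ s z h) => //.
by rewrite -sE subrKC subrr; apply: low0.
Qed.

(** Factor the product of the elements attached to [p] and [q], then compare logarithmic values of
    both sides; the factor [h] contributes zero. *)
Lemma dlog_solve p q : (forall j, low 1 (p j)) -> (forall j, low 1 (q j)) ->
  exists2 z, forall j, low 1 (z j) &
    forall i, low k.+1 (dlog z i - (dlog p i + dlog q i)).
Proof.
move=> p1 q1; set g := starB (wprod p) (wprod q).
have g1 : low 1 g by apply: low_star; apply: low_wprod.
have [z [h [z1 h1 hl gzh]]] := approxP k g1.
exists z => // i.
have pq := log_val_star (log_val_wprod p1) (log_val_wprod q1).
have zh := log_val_star (log_val_wprod z1) hl.
have := log_val_inj g1 gzh pq zh i.
by rewrite addr0 -opprD opprK addrC.
Qed.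

End Integrality.

(** * Monomials of powers and the Newton polytope *)

Section NewtonPowers.
Variables (RR : realType) (d : nat) (R : comNzRingType) (f : laurent d R).

Lemma newton_conv (t : RR) x y : 0 <= t -> t <= 1 ->
  newton RR f x -> newton RR f y -> newton RR f (t *: x + (1 - t) *: y).
Proof.
move=> t0 t1 fx fy C fC; have [cC _] := fC.
have := cC x y (Itv01 t0 t1); rewrite !inE; apply.
  exact: fx fC.
exact: fy fC.
Qed.

Lemma newton_mem u : f u != 0 -> newton RR f (embZ RR u).
Proof. by move=> fu C [_]; apply; exists u. Qed.

Lemma embZD u v : embZ RR (u + v : 'rV[int]_d) = embZ RR u + embZ RR v.
Proof. exact: raddfD. Qed.

(** A monomial of [f ^ n] is a sum of [n] exponents of [f], so the point in question is a mean of
    [n + 1] points of the polytope. *)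
Lemma newton_lpow n m y : lpow f n m != 0 -> newton RR f y ->
  newton RR f (n.+1%:R^-1 *: (embZ RR m + y)).
Proof.
elim: n m y => [|n IH] m y /=.
  rewrite loneE; have [->|_] := eqVneq m 0; last by rewrite eqxx.
  by rewrite /embZ raddf0 add0r invr1 scale1r.
rewrite lmulE => fm fy.
have [u uf] : exists2 u, u \in finsupp f & f u * lpow f n (m - u) != 0.
  apply: contrapT => H; case/eqP: fm; rewrite big_seq big1 // => u uf.
  by apply: contrapT => /eqP fu; apply: H; exists u.
have [->|fu0] := eqVneq (f u) 0; first by rewrite mul0r eqxx.
have [->|fmu _] := eqVneq (lpow f n (m - u)) 0; first by rewrite mulr0 eqxx.
(* The new exponent [u] gets weight [1 / (n + 2)]; the mean of the other [n + 1] points gets the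
   rest. *)
have := newton_conv _ _ (newton_mem fu0) (IH _ _ fmu fy) (t := n.+2%:R^-1).
rewrite invr_ge0 ler0n invf_le1 ?ltr0n // ler1n => /(_ isT isT).
congr (newton RR f); rewrite scalerA.
have -> : (1 - n.+2%:R^-1) * n.+1%:R^-1 = n.+2%:R^-1 :> RR.
  have n2 : n.+2%:R != 0 :> RR by rewrite pnatr_eq0.
  have n1 : n.+1%:R != 0 :> RR by rewrite pnatr_eq0.
  apply: (mulfI n2); apply: (mulIf n1).
  rewrite [_ * (_ * _)]mulrA mulfVK // mulrBr mulfV // mul1r mulr1.
  by rewrite -[n.+2]addn1 natrD addrK.
by rewrite -scalerDr addrA -embZD subrKC.
Qed.

(** [u] is the mean of [v] and [n] exponents of [f]. Moving [v] inside a neighbourhood contained in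
    the polytope moves this mean over a neighbourhood of [u]. *)
Lemma interior_lattice_lpow n u v : interior_lattice RR f v ->
  lpow f n (u *+ n.+1 - v) != 0 -> interior_lattice RR f u.
Proof.
rewrite /interior_lattice /= => fv fu.
set m := u *+ n.+1 - v in fu.
(* The inverse of the averaging map sending [y] to [(m + y) / (n + 1)]. *)
pose g (x : 'rV[RR]_d) := n.+1%:R *: x - embZ RR m.
have gu : g (embZ RR u) = embZ RR v.
  rewrite /g scaler_nat -raddfMn /= -[RHS](addrK (embZ RR m)) -embZD.
  by rewrite /m subrKC.
have gc : {for embZ RR u, continuous g}.
  by apply: continuousB; [exact: scaler_continuous|exact: cst_continuous].
have gn : nbhs (embZ RR u) (g @^-1` newton RR f)%classic.
  by apply: gc; rewrite gu.
apply: (filterS _ gn) => x gx; have := newton_lpow fu gx.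
by rewrite /g subrKC scalerA mulVf ?scale1r // pnatr_eq0.
Qed.

End NewtonPowers.

(** * The formal group law *)

Lemma ps_comp0 M N (K : comNzRingType) (G : mpowser M K)
    (H : 'I_M -> mpowser N K) :
  G (@mnm0 M) = 0 -> ps_comp G H (@mnm0 N) = 0.
Proof.
move=> G0; rewrite ps_compE big1 // => u _.
suff -> : bmnm u = @mnm0 M by rewrite G0 mul0r.
apply/eqP; rewrite -mdeg_eq0 -leqn0 -ltnS.
by apply: leq_trans (bmdeg u) _; rewrite mdeg0.
Qed.

Lemma agree_in_var N (K : comNzRingType) k (g : 'I_N -> nat -> K) :
  (forall j, g j 0%N = 0) ->
  agree k (fun m => \sum_j ps_in_var j (g j) m)
    (* Exponents run from 1 to [k + 1], one further than degree [k] requires, to match the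
       truncation in [dlog]. *)
    (fun m => mcoeff m (\sum_j \sum_(n < k.+1)
                          g j n.+1 *: mpolyX K (mnm1 j) ^+ n.+1)).
Proof.
move=> g0 m mk; rewrite raddf_sum /=; apply: eq_bigr => j _.
rewrite raddf_sum /=.
under eq_bigr do rewrite mcoeffZ mcoeffXn.
rewrite /ps_in_var; case: eqP => [mE|mE]; last first.
  rewrite big1 // => n _; case: eqP => [e|_]; last by rewrite mulr0.
  by case: mE; rewrite -e mulmnE mnm1E eqxx mul1n.
have mjk : (m j <= k)%N.
  by apply: leq_trans mk; rewrite mdegE (bigD1 j) //= leq_addr.
case mj : (m j) => [|a].
  rewrite g0 big1 // => n _; case: eqP => [e|_]; last by rewrite mulr0.
  by move: mj; rewrite -e mulmnE mnm1E eqxx mul1n.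
have ak : (a < k.+1)%N by rewrite mj in mjk; apply: ltnW.
rewrite (bigD1 (Ordinal ak)) //= -mj -mE eqxx mulr1 big1 ?addr0 // => n na.
case: eqP => [e|_]; last by rewrite mulr0.
case/eqP: na; apply: val_inj; apply: succn_inj => /=.
by rewrite -mj -e mulmnE mnm1E eqxx mul1n.
Qed.

Section LaurentIntegrality.
Variables (RR : realType) (d : nat) (R RQ : comNzRingType).
Variables (iR : {rmorphism R -> RQ}) (iQ : {rmorphism rat -> RQ}).
Variable f : laurent d R.
Let pts := interior_pts RR f.
Let N := size pts.
Let w (j : 'I_N) : 'rV[int]_d := nth 0 pts j.
Let L : 'I_N -> mpowser N RQ := @logL RR d R RQ iR iQ f.
Let beta (i : 'I_N) e n := lpow f n (e *+ n.+1 - w i).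

Let beta_notin i e n : (forall j, e != w j) -> beta i e n = 0.
Proof.
move=> ew; apply/eqP; apply: contraT => nz.
have wi : interior_lattice RR f (w i).
  by apply/interior_ptsE; rewrite mem_nth.
have /interior_ptsE ep := interior_lattice_lpow wi nz.
have epN : (index e pts < N)%N by rewrite index_mem.
by have := ew (Ordinal epN); rewrite /w /= nth_index // eqxx.
Qed.

Let tau (e : 'rV[int]_d) : laurent d R := lmono (- e) 1.

Let tau_gen (x : laurent d R) : exists s : seq (R * 'rV[int]_d),
  x = \sum_(re <- s) @lconst d R re.1 * tau re.2.
Proof.
exists [seq (x u, - u) | u <- finsupp x].
rewrite big_map {1}(laurent_lmono x); apply: eq_bigr => u _ /=.
by rewrite /tau opprK /lconst lmonoM add0r mulr1.
Qed.

Let ev (i : 'I_N) : {additive laurent d R -> R} := lcoef (- w i).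

Let ev_beta i r e n :
  ev i (@lconst d R r * (f ^+ n * tau e ^+ n.+1)) = r * beta i e n.
Proof.
rewrite /ev /= /lcoef /lconst lmonoME subr0 /tau lmonoX.
by rewrite (mulrC (f ^+ n)) lmonoME mul1r -lpowE mulNrn opprK addrC.
Qed.

Let natQ n : iQ n.+1%:R^-1 *+ n.+1 = 1.
Proof.
by rewrite -raddfMn /= -[X in iQ X]mulr_natl mulfV ?rmorph1 // pnatr_eq0.
Qed.

(** [RQ] is a rational algebra through [iQ], so the Euler derivative determines every coefficient of
    positive degree. *)
Let torsion_free n (x : RQ) : x *+ n.+1 = 0 -> x = 0.
Proof. by move=> xn; rewrite -[x]mulr1 -(natQ n) mulrnAr -mulrnAl xn mul0r. Qed.

Let logpoly k i : mpoly N RQ := \sum_j \sum_(n < k.+1)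
  logLvw iR iQ f (w i) (w j) n.+1 *: mpolyX RQ (mnm1 j) ^+ n.+1.

Let agree_logpoly k i : agree k (L i) (fun m => mcoeff m (logpoly k i)).
Proof. exact: agree_in_var. Qed.

Let low_logpoly k i : low 1 (logpoly k i).
Proof.
do 2![apply: low_sum => ? _]; rewrite -mul_mpolyC; apply: lowMl.
rewrite exprS; apply: lowMr => m; rewrite ltnS leqn0 mdeg_eq0 => /eqP->.
by rewrite mcoeffX mnm1_eq0.
Qed.

Let mapz V (z : 'I_N -> mpoly V R) := [tuple map_mpoly iR (z j) | j < N].

(** The factor [n + 1] from differentiating a power cancels the denominator in [logLvw]. *)
Let euler_logpoly V k (z : 'I_N -> mpoly V R) i :
  euler (comp_mpoly (mapz z) (logpoly k i)) = map_mpoly iR (dlog k w beta z i).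
Proof.
rewrite /logpoly /dlog (raddf_sum (comp_mpoly _)) /=.
rewrite (raddf_sum (@euler V RQ)) (raddf_sum (map_mpoly iR)) /=.
apply: eq_bigr => j _; rewrite (raddf_sum (comp_mpoly _)) /=.
rewrite (raddf_sum (@euler V RQ)) (raddf_sum (map_mpoly iR)) /=.
apply: eq_bigr => n _.
rewrite comp_mpolyZ rmorphXn /= comp_mpolyXU -tnth_nth tnth_mktuple.
rewrite eulerZ eulerX map_mpolyZ rmorphM rmorphXn /= euler_map.
by rewrite -scalerMnr scalerMnl /logLvw /= -mulrnAr natQ mulr1.
Qed.

Let low_mapz V (z : 'I_N -> mpoly V R) :
  (forall j, low 1 (z j)) -> forall j, low 1 (tnth (mapz z) j).
Proof.
move=> z1 j m m1; rewrite tnth_mktuple mcoeff_map_mpoly z1 //.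
exact: raddf0.
Qed.

Lemma laurent_log_solve V k (p q : 'I_N -> mpoly V R) :
  (forall j, low 1 (p j)) -> (forall j, low 1 (q j)) ->
  exists2 z : 'I_N -> mpoly V R, forall j, low 1 (z j) &
  forall i, low k.+1 (comp_mpoly (mapz z) (logpoly k i)
    - (comp_mpoly (mapz p) (logpoly k i) + comp_mpoly (mapz q) (logpoly k i))).
Proof.
move=> p1 q1.
have [z z1 zpq] := dlog_solve k tau_gen ev_beta beta_notin p1 q1.
exists z => // i m mk.
have lc (x : 'I_N -> mpoly V R) : (forall j, low 1 (x j)) ->
    low 1 (comp_mpoly (mapz x) (logpoly k i)).
  by move=> x1; apply: low_comp => //; apply: low_mapz.
(* The Euler derivative loses the constant term, but all the terms compared here have none. *)
case: (posnP (mdeg m)) => [m0|m0].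
  have low1 := lowB (lc _ z1) (lowD (lc _ p1) (lc _ q1)).
  by apply: (low1 m); rewrite m0.
apply: (@torsion_free (mdeg m).-1); rewrite prednK // -mcoeff_euler.
rewrite eulerB eulerD !euler_logpoly -(raddfD (map_mpoly iR)).
by rewrite -(raddfB (map_mpoly iR)) /= mcoeff_map_mpoly zpq ?raddf0.
Qed.

Lemma laurent_fg_integral i m : exists r : R, laurent_fg RR iR iQ f i m = iR r.
Proof.
set k := mdeg m.
pose x j : mpoly (N + N) R := mpolyX R (mnm1 (lshift N j)).
pose y j : mpoly (N + N) R := mpolyX R (mnm1 (rshift N j)).
have X1 (j : 'I_(N + N)) : low 1 (mpolyX R (mnm1 j)).
  move=> u; rewrite ltnS leqn0 mdeg_eq0 => /eqP->.
  by rewrite mcoeffX mnm1_eq0.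
have [z z1 zxy] := laurent_log_solve k (fun j => X1 (lshift N j))
                                       (fun j => X1 (rshift N j)).
(* The candidate with coefficients from [R]; it has to match the formal group law only up to the
   degree [k] of the chosen monomial. *)
pose H j (u : multinom (N + N)) := mcoeff u (map_mpoly iR (z j)).
exists (mcoeff m (z i)); rewrite -mcoeff_map_mpoly -[RHS]/(H i m).
pose S j u := ps_comp (L j) (fun k => ps_X RQ (lshift N k)) u
            + ps_comp (L j) (fun k => ps_X RQ (rshift N k)) u.
have L0 j : L j (@mnm0 N) = 0 by exact: logL0.
have L1 j j' : L j (mnm1 j') = (j == j')%:R by exact: logL1.
have S0 j : S j (@mnm0 _) = 0 by rewrite /S !ps_comp0 // addr0.
have agL (v : 'I_N -> mpoly (N + N) R) (G : 'I_N -> mpowser (N + N) RQ) j :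
    (forall j, low 1 (v j)) ->
    (forall j, agree k (G j) (fun u => mcoeff u (map_mpoly iR (v j)))) ->
    agree k (ps_comp (L j) G)
            (fun u => mcoeff u (comp_mpoly (mapz v) (logpoly k j))).
  move=> v1 Gv; apply: agree_comp_mpoly => // j'.
  by have := low_mapz v1 j'; rewrite tnth_mktuple.
have agX (e : 'I_N -> 'I_(N + N)) j : agree k (ps_X RQ (e j))
    (fun u => mcoeff u (map_mpoly iR (mpolyX R (mnm1 (e j))))).
  by move=> u _; rewrite map_mpolyX mcoeffX /ps_X eq_sym.
have LH j : agree k (ps_comp (L j) H) (S j).
  move=> u uk; rewrite (agL z) // /S.
  rewrite (agL x) ?(agL y) //; try exact: agX; try by move=> ?; apply: X1.
  by rewrite -mcoeffD; apply: low_eq (zxy j) _.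
(* The formal group law satisfies the same equation exactly, so injectivity of composition with [L]
   identifies it with [H] up to degree [k]. *)
have LF j u : ps_comp (L j) (laurent_fg RR iR iQ f) u = S j u.
  rewrite -[laurent_fg _ _ _ _]/(fun i => ps_comp (ps_inv L i) S).
  rewrite -ps_compA //; last by move=> ?; apply: ps_inv0.
  have -> : ps_comp (L j) (ps_inv L) = ps_X RQ j.
    by apply/funext => v; apply: ps_comp_inv.
  exact: ps_compX.
apply: (@ps_comp_inj _ _ _ L _ _ k) => //.
- move=> j; apply: ps_comp0; exact: ps_inv0.
- by move=> j; rewrite /H mcoeff_map_mpoly z1 ?mdeg0 // raddf0.
- by move=> j u uk; rewrite LF LH.
Qed.

End LaurentIntegrality.

Theorem theorem1p2 (RR : realType) (d : nat)
    (R : comNzRingType) (hR : flatZ R)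
    (RQ : comNzRingType) (iR : {rmorphism R -> RQ}) (iQ : {rmorphism rat -> RQ})
    (hRQ : is_tensorZ (fun (r : R) (q : rat) => iR r * iQ q))
    (f : laurent d R)
    (hdim : has_dim (newton RR f) d)
    (hint : exists v : 'rV[int]_d, interior_lattice RR f v) :
  forall i m, exists r : R, laurent_fg RR iR iQ f i m = iR r.
Proof. exact: laurent_fg_integral. Qed.
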